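(* Let $n\ge 1$ and let $\epsilon,\delta>0$ be real numbers with $\epsilon\geq\delta$. Then being chaotic is a topologically generic property in $\operatorname{Del}_{\epsilon,\delta}$; that is, the set of chaotic Delone sets $S\in \operatorname{Del}_{\epsilon,\delta}$ contains a countable intersection of open dense subsets of $\operatorname{Del}_{\epsilon,\delta}$.
   Context: A subset $S$ of a metric space $X$ is $(\epsilon,\delta)$-Delone if (i) for every $x\in X$ there is $y\in S$ with $d(x,y)\leq\epsilon$, and (ii) $d(x,y)\geq\delta$ for all $x,y\in S$ with $x\neq y$. $\operatorname{Del}_{\epsilon,\delta}$ denotes the set of $(\epsilon,\delta)$-Delone subsets of $\mathbb{R}^n$ (Euclidean metric). It is endowed with the local rubber topology, a compact metrisable topology induced by the uniformity having as a base of entourages the sets $$N_{U,U'}=\{(S,S')\in \operatorname{Del}_{\epsilon,\delta}\times \operatorname{Del}_{\epsilon,\delta}\mid S\cap U\subset S'+U' \text{ and } S'\cap U\subset S+U'\},$$ where $U,U'$ range over open neighbourhoods of the origin in $\mathbb{R}^n$ with $U$ precompact. $\mathbb{R}^n$ acts continuously on $\operatorname{Del}_{\epsilon,\delta}$ by $(v,S)\mapsto S-v=\{s-v\mid s\in S\}$. The orbit of $S$ is denoted $[S]$ and its closure $\overline{[S]}$. A Delone set $S$ is periodic if $[S]$ is compact (equivalently, its stabilizer in $\mathbb{R}^n$ is a lattice); then $[S]$ is called a periodic orbit. $S$ is almost chaotic if the union of the periodic orbits contained in $\overline{[S]}$ is dense in $\overline{[S]}$. $S$ is aperiodic if $S-v\neq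 S$ for all $v\in\mathbb{R}^n\setminus\{0\}$. $S$ is chaotic if it is almost chaotic and aperiodic. *)

(* Defs.v *)
From HB Require Import structures.
From mathcomp Require Import all_boot all_order all_algebra.
From mathcomp Require Import all_classical all_reals all_analysis.

Set Implicit Arguments.
Unset Strict Implicit.
Unset Printing Implicit Defensive.
Import Order.TTheory GRing.Theory Num.Theory.
Import numFieldNormedType.Exports.
Local Open Scope classical_set_scope.
Local Open Scope ring_scope.

(* The norm that the library puts on 'rV[R]_n is the sup norm, so the Euclidean
   distance is written out; both induce the same topology on 'rV[R]_n. *)
Definition edist (R : realType) (n : nat) (x y : 'rV[R]_n) : R :=
  Num.sqrt (\sum_(i < n) (x ord0 i - y ord0 i) ^+ 2).

Definition is_delone (R : realType) (n : nat) (eps del : R)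
    (S : set 'rV[R]_n) : Prop :=
  (forall x, exists2 y, S y & edist x y <= eps) /\
  (forall x y, S x -> S y -> x <> y -> del <= edist x y).

Definition translate (R : realType) (n : nat) (v : 'rV[R]_n)
    (S : set 'rV[R]_n) : set 'rV[R]_n := [set s - v | s in S].

Definition minkowski (R : realType) (n : nat) (A B : set 'rV[R]_n) :
  set 'rV[R]_n := [set a + b | a in A & b in B].

(* A record of its own rather than the subtype of [set 'rV[R]_n], so that no
   topology is inherited and the local rubber one, whose uniformity has the
   base of entourages [rubber U U'], can be canonical. *)
Record delone_set (R : realType) (n : nat) (eps del : R) := DeloneSet {
  delone_val :> set 'rV[R]_n;
  delone_valP : is_delone eps del delone_val }.

Section Delone.
Variables (R : realType) (n : nat) (eps del : R).
Local Notation Del := (delone_set n eps del).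

HB.instance Definition _ := gen_eqMixin Del.
HB.instance Definition _ := gen_choiceMixin Del.

Lemma delone_val_inj : injective (@delone_val R n eps del).
Proof.
move=> [A hA] [B hB] /= AB; subst B; congr DeloneSet; exact: Prop_irrelevance.
Qed.

Definition rubber (U U' : set 'rV[R]_n) : set (Del * Del) :=
  [set p : Del * Del | delone_val p.1 `&` U `<=` minkowski (delone_val p.2) U' /\
           delone_val p.2 `&` U `<=` minkowski (delone_val p.1) U'].

Definition rubber_ent : set_system (Del * Del) :=
  [set E | exists U U' : set 'rV[R]_n,
     [/\ open U, U 0 & precompact U] /\ [/\ open U', U' 0 & rubber U U' `<=` E]].

Lemma minkowskiS (A B C : set 'rV[R]_n) :
  B `<=` C -> minkowski A B `<=` minkowski A C.
Proof. by move=> BC _ [a Aa [b Bb <-]]; exists a => //; exists b => //; exact: BC. Qed.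

Lemma open_ball0 (r : R) : open (ball (0 : 'rV[R]_n) r).
Proof. exact: ball_open. Qed.

Lemma precompact_ball0 (r : R) : precompact (ball (0 : 'rV[R]_n) r).
Proof.
exists (closed_ball_ (fun x : 'rV[R]_n => `|x|) 0 r).
  by rewrite -ball_normE => x /=; exact: ltW.
have cl : closed (closed_ball_ (fun x : 'rV[R]_n => `|x|) 0 r).
  exact: closed_closed_ball_.
split=> //; apply: bounded_closed_compact => //.
exists r; split; first exact: num_real.
by move=> M rM x; rewrite /closed_ball_ /= sub0r normrN => /le_trans; apply; exact: ltW.
Qed.

Lemma precompact_bounded (U : set 'rV[R]_n) :
  precompact U -> exists2 M : R, 0 < M & U `<=` ball 0 M.
Proof.
move=> [K UK [cK _]].
have [M [_ hM]] := compact_bounded cK.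
exists (`|M| + 2); first by rewrite ltr_wpDl.
move=> x /UK Kx; rewrite -ball_normE /= sub0r normrN.
have M1 : M < `|M| + 1 by rewrite (le_lt_trans (ler_norm M))// ltrDl.
by apply: le_lt_trans (hM _ M1 _ Kx) _; rewrite ltrD2l ltr1n.
Qed.

Lemma rubber_ent_filter : Filter rubber_ent.
Proof.
split.
- exists (ball 0 1), (ball 0 1); split; split=> //.
  + exact: open_ball0. + exact: ballxx. + exact: precompact_ball0.
  + exact: open_ball0. + exact: ballxx.
- move=> P Q [U [U' [[oU U0 cU] [oU' U'0 UP]]]] [V [V' [[oV V0 cV] [oV' V'0 VQ]]]].
  have [M M0 UM] := precompact_bounded cU.
  have [N N0 VN] := precompact_bounded cV.
  exists (U `|` V), (U' `&` V'); split; split.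
  + exact: openU. + by left.
  + apply: (@precompact_subset _ _ (ball 0 (M + N))); last exact: precompact_ball0.
    move=> x [/UM|/VN]; apply: le_ball; [by rewrite lerDl ltW|by rewrite lerDr ltW].
  + exact: openI. + by split.
  + move=> [S T] [/= h1 h2]; split; [apply: UP|apply: VQ]; split=> /= x [Sx Ux].
    * by apply: (@minkowskiS _ (U' `&` V')) => [?[]//|]; apply: h1; split=> //; left.
    * by apply: (@minkowskiS _ (U' `&` V')) => [?[]//|]; apply: h2; split=> //; left.
    * by apply: (@minkowskiS _ (U' `&` V')) => [?[]//|]; apply: h1; split=> //; right.
    * by apply: (@minkowskiS _ (U' `&` V')) => [?[]//|]; apply: h2; split=> //; right.
- move=> P Q PQ [U [U' [hU [oU' U'0 UP]]]].
  by exists U, U'; split=> //; split=> //; exact: subset_trans PQ.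
Qed.

Local Open Scope relation_scope.

Lemma rubber_ent_refl A : rubber_ent A -> diagonal `<=` A.
Proof.
move=> [U [U' [_ [_ U'0 UA]]]] [S T] /= ST; apply: UA; rewrite /diagonal /= in ST.
by subst T; split=> /= x [Sx _]; exists x => //; exists 0 => //; rewrite addr0.
Qed.

Lemma rubber_ent_inv A : rubber_ent A -> rubber_ent A^-1.
Proof.
move=> [U [U' [hU [oU' U'0 UA]]]]; exists U, U'; split=> //; split=> //.
by move=> [S T] [h1 h2]; apply: UA; split.
Qed.

Lemma rubber_ent_split A :
  rubber_ent A -> exists2 B, rubber_ent B & B \; B `<=` A.
Proof.
move=> [U [U' [[oU U0 cU] [oU' U'0 UA]]]].
have [M M0 UM] := precompact_bounded cU.
have /nbhs_ballP[r /= r0 rU'] : nbhs (0 : 'rV[R]_n) U' by exact: open_nbhs_nbhs.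
pose V := ball (0 : 'rV[R]_n) (M + r / 2).
pose V' := ball (0 : 'rV[R]_n) (r / 2).
have r20 : 0 < r / 2 by rewrite divr_gt0.
have step (S T W : Del) : delone_val S `&` V `<=` minkowski T V' ->
    delone_val T `&` V `<=` minkowski W V' ->
    delone_val S `&` U `<=` minkowski W U'.
  move=> ST TW x [Sx Ux].
  have xM : `|x| < M by have := UM _ Ux; rewrite -ball_normE /= sub0r normrN.
  have [|t Tt [b Vb tbx]] := ST x.
    split=> //; rewrite /V -ball_normE /= sub0r normrN.
    by rewrite (lt_trans xM)// ltrDl.
  have bn : `|b| < r / 2 by move: Vb; rewrite /V' -ball_normE /= sub0r normrN.
  have [|w Ww [c Vc wct]] := TW t.
    split=> //; rewrite /V -ball_normE /= sub0r normrN.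
    have -> : t = x - b by rewrite -tbx addrK.
    by rewrite (le_lt_trans (ler_normB _ _))// ltrD.
  have cn : `|c| < r / 2 by move: Vc; rewrite /V' -ball_normE /= sub0r normrN.
  exists w => //; exists (c + b); last by rewrite addrA wct.
  apply: rU'; rewrite -ball_normE /= sub0r normrN.
  by rewrite (le_lt_trans (ler_normD _ _))// [ltRHS](splitr r) ltrD.
exists (rubber V V').
  exists V, V'; split; split=> //.
  - exact: open_ball0. - by apply: ballxx; rewrite addr_gt0.
  - exact: precompact_ball0.
  - exact: open_ball0. - exact: ballxx.
move=> [S W] [T [/= ST TS] [/= TW WT]]; apply: UA; split=> /=.
  exact: step TW.
exact: step TS.
Qed.

Local Close Scope relation_scope.

HB.instance Definition _ := @isUniform.Build Del
  rubber_ent rubber_ent_filter rubber_ent_refl rubber_ent_inv rubber_ent_split.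

Lemma translate_is_delone (v : 'rV[R]_n) (S : set 'rV[R]_n) :
  is_delone eps del S -> is_delone eps del (translate v S).
Proof.
have edistB (x y : 'rV[R]_n) : edist (x - v) (y - v) = edist x y.
  congr Num.sqrt; apply: eq_bigr => i _.
  by rewrite !mxE opprD addrACA opprK addNr addr0.
move=> [cov sep]; split.
  move=> x; have [y Sy xy] := cov (x + v).
  by exists (y - v); [exists y|rewrite -(addrK v x) edistB].
by move=> _ _ [s Ss <-] [t St <-] st; rewrite edistB; apply: sep => // E; rewrite E in st.
Qed.

Definition delone_translate (v : 'rV[R]_n) (S : Del) : Del :=
  DeloneSet (translate_is_delone v (@delone_valP _ _ _ _ S)).

Definition delone_orbit (S : Del) : set Del :=
  range (fun v => delone_translate v S).

Definition periodic (S : Del) : Prop := compact (delone_orbit S).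

(* The union below lies in the closure of the orbit of [S], so the inclusion
   says that it is dense in that closure. *)
Definition almost_chaotic (S : Del) : Prop :=
  closure (delone_orbit S) `<=`
  closure (\bigcup_(T in [set T | periodic T /\
                           delone_orbit T `<=` closure (delone_orbit S)])
             delone_orbit T).

(* By [delone_val_inj], the inequality is one between sets of vectors. *)
Definition aperiodic (S : Del) : Prop :=
  forall v : 'rV[R]_n, v != 0 -> delone_translate v S <> S.

Definition chaotic (S : Del) : Prop := almost_chaotic S /\ aperiodic S.

End Delone.

(* Main.v *)
From Pilot Require Import Defs.
From mathcomp Require Import all_boot all_order all_algebra.
From mathcomp Require Import all_classical all_reals all_analysis.
From mathcomp Require Import ring lra.
Import Order.TTheory GRing.Theory Num.Theory.
Import numFieldNormedType.Exports.
Import Pilot.Defs.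
Local Open Scope classical_set_scope.
Local Open Scope ring_scope.

(** Generic chaos follows from generic density of the orbit.

    The tool behind everything is that patches of Delone sets can be prescribed
    at will on balls that are far apart.  Since [del <= eps], a [del]-separated
    set to which no point can be added leaves no point uncovered; so a separated
    patch extends, by Zorn's lemma, to a Delone set.  If the added points are
    kept away from a region that the patch already covers, the patch does not
    change there, and if whole orbits of a group of translations are added, the
    extension keeps the invariance under that group ([extend_separated]).  Hence
    a family of Delone sets indexed by Z^n is realised, around the points of a
    lattice [L Z^n], by one Delone set, whose invariance under [L p] is inherited
    from the invariance of the family under [p] ([glue]).

    A constant family gives a lattice-invariant Delone set near any given one:
    periodic orbits are dense in the whole space ([periodic_dense]).  A family
    equal to [S] at the origin and to [T] elsewhere gives a Delone set near [S]
    whose orbit passes near [T]: the sets whose orbit visits a given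
    neighbourhood of [T] form an open dense set ([open_visits], [dense_visits]).

    At each scale, countably many neighbourhoods cover the space, because a
    Delone set is determined up to that scale by the cells of a finite grid that
    it meets ([countable_rubber_cover]).  The corresponding countably many open
    dense sets intersect in sets [S] with dense orbit.  Such an [S] is almost
    chaotic, as periodic orbits are dense in the closure of its orbit, which is
    the whole space.  It is aperiodic, since a period of [S] would be a period of
    every Delone set, while some Delone set contains [0] and a point slightly
    beyond [v], hence not [v] itself ([dense_orbit_aperiodic]). *)

Set Implicit Arguments.
Unset Strict Implicit.
Unset Printing Implicit Defensive.

(** * The Euclidean distance and the sup norm *)

Section EuclideanDistance.
Context {R : realType} {n : nat}.
Implicit Types (x y z : 'rV[R]_n) (r : R).

Lemma edistC x y : edist x y = edist y x.
Proof. by congr Num.sqrt; apply: eq_bigr => i _; rewrite -sqrrN opprB. Qed.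

Lemma edistxx x : edist x x = 0.
Proof. by rewrite /edist big1 ?sqrtr0// => i _; rewrite subrr expr0n. Qed.

Lemma edist_subr x y z : edist x (y + z) = edist (x - z) y.
Proof.
by congr Num.sqrt; apply: eq_bigr => i _; rewrite !mxE [y _ _ + _]addrC opprD addrA.
Qed.

Lemma edistDr x y z : edist (x + z) (y + z) = edist x y.
Proof. by rewrite edist_subr addrK. Qed.

Lemma edist0Z (a : R) x : 0 <= a -> edist 0 (a *: x) = a * edist 0 x.
Proof.
move=> a0; have {2}-> : a = Num.sqrt (a ^+ 2) by rewrite sqrtr_sqr ger0_norm.
rewrite /edist -sqrtrM ?sqr_ge0// mulr_sumr.
by congr Num.sqrt; apply: eq_bigr => i _; rewrite !mxE !sub0r !sqrrN exprMn.
Qed.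

Lemma coord_le_norm x i : `|x ord0 i| <= `|x|.
Proof.
rewrite [`|x|]mx_normrE.
exact: (le_bigmax 0 (fun ij : 'I_1 * 'I_n => `|x ij.1 ij.2|) (ord0, i)).
Qed.

Lemma norm_le_coord x r : 0 <= r -> (forall i, `|x ord0 i| <= r) -> `|x| <= r.
Proof.
move=> r0 xr; rewrite [`|x|]mx_normrE; apply/bigmax_leP; split=> // -[j i] _ /=.
by rewrite (ord1 j).
Qed.

Lemma norm_lt_coord x r : 0 < r -> (forall i, `|x ord0 i| < r) -> `|x| < r.
Proof.
move=> r0 xr; rewrite [`|x|]mx_normrE; apply/bigmax_ltP; split=> // -[j i] _ /=.
by rewrite (ord1 j).
Qed.

Lemma mem_ball0 x r : ball (0 : 'rV[R]_n) r x = (`|x| < r) :> Prop.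
Proof. by rewrite -ball_normE /= sub0r normrN. Qed.

Lemma norm_le_edist x y : `|x - y| <= edist x y.
Proof.
apply: norm_le_coord => [|i]; first exact: sqrtr_ge0.
rewrite -sqrtr_sqr ler_wsqrtr// !mxE (bigD1 i)//= lerDl.
by apply: sumr_ge0 => j _; exact: sqr_ge0.
Qed.

Lemma edist_le_norm x y : edist x y <= n%:R * `|x - y|.
Proof.
have nxy : 0 <= n%:R * `|x - y| by rewrite mulr_ge0.
rewrite -(ger0_norm nxy) -sqrtr_sqr ler_wsqrtr//.
apply: (@le_trans _ _ (\sum_(i < n) `|x - y| ^+ 2)).
  apply: ler_sum => i _; rewrite -real_normK ?num_real// lerXn2r ?nnegrE//.
  by have := coord_le_norm (x - y) i; rewrite !mxE.
rewrite sumr_const card_ord exprMn -[leLHS]mulr_natl ler_wpM2r ?sqr_ge0//.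
by rewrite -natrX ler_nat; case: (n) => // m; rewrite expnS leq_pmulr// expn_gt0.
Qed.

End EuclideanDistance.

(** * Extension of separated sets *)

Section Extension.
Context {R : realType} {n : nat}.
Variables (eps del : R).
Hypotheses (del_gt0 : 0 < del) (del_le_eps : del <= eps).

Definition separated (A : set 'rV[R]_n) : Prop :=
  forall x y, A x -> A y -> x <> y -> del <= edist x y.

Definition invariant_under (G A : set 'rV[R]_n) : Prop :=
  forall g x, G g -> A x -> A (x + g).

(** A set [W] is sought that is maximal among the [G]-invariant sets that keep
    [P `|` W] separated and add nothing to [P] inside [K].  A point [x] at
    distance more than [eps] from [P `|` W] lies outside [K], and its whole orbit
    [x + G] is that far from the invariant set [P `|` W]; the orbit is itself
    separated, so it could be added to [W], against maximality. *)
Lemma extend_separated (G P K : set 'rV[R]_n) :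
  G 0 -> (forall g h, G g -> G h -> G (g - h)) ->
  (forall g, G g -> g <> 0 -> del <= edist 0 g) ->
  separated P -> invariant_under G P -> invariant_under G K ->
  (forall x, K x -> exists2 y, P y & edist x y <= eps) ->
  exists W : set 'rV[R]_n,
    [/\ is_delone eps del W, invariant_under G W, P `<=` W & W `&` K `<=` P].
Proof.
move=> G0 GB Gdel sepP invP invK covK.
(* The condition is put on [P `|` W] rather than on a superset of [P], so that
   the union of the empty chain satisfies it. *)
pose Q (W : set 'rV[R]_n) :=
  [/\ separated (P `|` W), invariant_under G W & W `&` K `<=` P].
have GN g : G g -> G (- g) by move=> Gg; rewrite -sub0r; exact: GB.
have [F FQ Ftot|W [[sepW invW WK] maxW]] := @Zorn_bigcup _ Q.
  split.
  - move=> x y [Px|[A FA Ax]] [Py|[B FB By]].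
    + exact: sepP.
    + by have [sB _ _] := FQ _ FB; apply: sB; [left|right].
    + by have [sA _ _] := FQ _ FA; apply: sA; [right|left].
    + have [AB|BA] := Ftot _ _ FA FB.
      * by have [sB _ _] := FQ _ FB; apply: sB; right; [exact: AB|].
      * by have [sA _ _] := FQ _ FA; apply: sA; right; [|exact: BA].
  - move=> g x Gg [A FA Ax]; exists A => //.
    by have [_ iA _] := FQ _ FA; exact: iA.
  - by move=> x [[A FA Ax] Kx]; have [_ _ AK] := FQ _ FA; apply: AK.
have invPW : invariant_under G (P `|` W).
  by move=> g x Gg [Px|Wx]; [left; exact: invP|right; exact: invW].
exists (P `|` W); split=> //; last first.
  by move=> x [[//|Wx] Kx]; apply: WK.
split=> // x; apply: contrapT => xfar.
have far y : (P `|` W) y -> eps < edist x y.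
  by move=> PWy; rewrite ltNge; apply/negP => xy; apply: xfar; exists y.
have NKx : ~ K x by move=> /covK[y Py xy]; apply: xfar; exists y => //; left.
have orbit_far g y : G g -> (P `|` W) y -> del <= edist (x + g) y.
  move=> Gg PWy; rewrite edistC edist_subr edistC.
  by rewrite (le_trans del_le_eps)// ltW// far//; exact: (invPW _ _ (GN _ Gg)).
pose B := W `|` [set x + g | g in G].
apply: (maxW B).
  split=> [y|BW]; first by left.
  have /far : (P `|` W) x by right; apply: BW; right; exists 0; rewrite ?addr0.
  by rewrite edistxx ltNge (le_trans (ltW del_gt0)).
have PB : P `|` B = (P `|` W) `|` [set x + g | g in G] by rewrite setUA.
split.
- rewrite PB => y z [PWy|[g Gg <-]] [PWz|[h Gh <-]].
  + exact: sepW.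
  + by move=> _; rewrite edistC; exact: orbit_far.
  + by move=> _; exact: orbit_far.
  + move=> gh; rewrite ![x + _]addrC edistDr -[g]add0r -[h](subrK g) edistDr.
    apply: Gdel; first exact: GB.
    by move=> /subr0_eq E; apply: gh; rewrite E.
- move=> g y Gg [Wy|[h Gh <-]]; first by left; exact: invW.
  right; exists (h + g); last by rewrite addrA.
  by rewrite -[g]opprK; apply: GB => //; exact: GN.
- move=> y [[Wy|[g Gg <-]] Ky]; first by apply: WK.
  by exfalso; apply: NKx; rewrite -(addrK g x); exact: (invK _ _ (GN _ Gg)).
Qed.

End Extension.

(** * Gluing Delone sets along a lattice *)

Section Gluing.
Context {R : realType} {n : nat}.
Variables (eps del : R).
Hypotheses (del_gt0 : 0 < del) (del_le_eps : del <= eps).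
Local Notation Del := (delone_set n eps del).

Definition lattice_point (L : R) (z : 'rV[int]_n) : 'rV[R]_n :=
  L *: map_mx intr z.

Lemma lattice_pointD L z z' :
  lattice_point L (z + z') = lattice_point L z + lattice_point L z'.
Proof. by rewrite /lattice_point map_mxD scalerDr. Qed.

Lemma lattice_pointB L z z' :
  lattice_point L (z - z') = lattice_point L z - lattice_point L z'.
Proof. by rewrite /lattice_point map_mxB scalerBr. Qed.

Lemma lattice_point0 L : lattice_point L 0 = 0.
Proof. by rewrite /lattice_point map_mx0 scaler0. Qed.

Lemma lattice_point_norm L z : 0 <= L -> z <> 0 -> L <= `|lattice_point L z|.
Proof.
move=> L0 z0; have [i zi] : exists i, z ord0 i != 0.
  apply: contrapT => zi; apply: z0; apply/rowP => i; rewrite mxE.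
  by apply/eqP/negPn/negP => zi0; apply: zi; exists i.
apply: le_trans (coord_le_norm _ i); rewrite !mxE normrM (ger0_norm L0).
by rewrite ler_peMr// -intr_norm ler1z -gtz0_ge1 normr_gt0.
Qed.

(** Around the lattice point of [z] the patch is the part of [S z] in the ball of
    radius [r + eps], which covers the ball of radius [r] within [eps].  The mesh
    [L] is large enough for patches around distinct points to be at distance at
    least [del].  The sup norm suffices for these estimates, as it is at most the
    Euclidean one. *)
Lemma glue (S : 'rV[int]_n -> Del) (r : R) : 0 < r ->
  exists (L : R) (W : Del), 0 < L /\
    (forall z x, `|x| < r ->
       delone_val W (x + lattice_point L z) <-> delone_val (S z) x) /\
    (forall p, (forall z, S (z + p) = S z) ->
       delone_translate (lattice_point L p) W = W).
Proof.
move=> r0; have e0 : 0 < eps by exact: lt_le_trans del_le_eps.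
pose L := 2 * (r + eps) + del.
have L0 : 0 < L by rewrite addr_gt0// mulr_gt0// addr_gt0.
pose lat := lattice_point L.
pose P := [set x | exists2 z, `|x - lat z| < r + eps & delone_val (S z) (x - lat z)].
pose K := [set x | exists z, `|x - lat z| < r].
pose G := [set lat p | p in [set p | forall z, S (z + p) = S z]].
have far z z' x y : z <> z' -> L <= `|x - lat z| + `|x - y| + `|y - lat z'|.
  move=> zz'; apply: (@le_trans _ _ `|lat (z' - z)|).
    by apply: lattice_point_norm => [|/subr0_eq/esym//]; exact: ltW.
  have -> : lat (z' - z) = (x - lat z) - (x - y) - (y - lat z').
    rewrite /lat lattice_pointB; move: (lattice_point L z) (lattice_point L z').
    by move=> a b; apply/rowP => i; rewrite !mxE; ring.
  by rewrite (le_trans (ler_normB _ _))// lerD2r ler_normB.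
have [W [Wdel WG PW WK]] : exists W : set 'rV[R]_n,
    [/\ is_delone eps del W, invariant_under G W, P `<=` W & W `&` K `<=` P].
  apply: (extend_separated del_gt0 del_le_eps).
  - by exists 0; [move=> z; rewrite addr0|exact: lattice_point0].
  - move=> _ _ [p pS <-] [q qS <-]; exists (p - q); last exact: lattice_pointB.
    by move=> z; rewrite -[LHS]qS addrA subrK pS.
  - move=> _ [p _ <-] p0; apply: le_trans (norm_le_edist _ _).
    have delL : del <= L by rewrite /L lerDr mulr_ge0// addr_ge0// ltW.
    rewrite sub0r normrN (le_trans delL)//; apply: lattice_point_norm => [|E].
      exact: ltW.
    by apply: p0; rewrite E; exact: lattice_point0.
  - move=> x y [z xz Sx] [z' yz' Sy] xy; have [E|/eqP/(far _ _ x y) zz'] := eqVneq z z'.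
      subst z'; rewrite -(edistDr x y (- lat z)).
      have [_ sepS] := delone_valP (S z); apply: sepS => // /subIr//.
    apply: le_trans (norm_le_edist _ _); move: xz yz' zz'; rewrite /L; lra.
  - move=> _ x [p pS <-] [z xz Sx]; exists (z + p);
      by rewrite /lat lattice_pointD opprD addrACA subrr addr0// pS.
  - move=> _ x [p pS <-] [z xz]; exists (z + p).
    by rewrite /lat lattice_pointD opprD addrACA subrr addr0.
  - move=> x [z xz]; have [cov _] := delone_valP (S z).
    have [y Sy xy] := cov (x - lat z); exists (y + lat z).
      exists z; rewrite addrK//; have -> : y = (x - lat z) - ((x - lat z) - y).
        by rewrite opprB addrC subrK.
      rewrite (le_lt_trans (ler_normB _ _))// ltr_leD//.
      exact: le_trans (norm_le_edist _ _) xy.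
    by rewrite edist_subr.
exists L, (DeloneSet Wdel); split=> //; split=> [z x xr|p pS].
  split=> /= [Wx|Sx]; last first.
    apply: PW; exists z; rewrite addrK//.
    by rewrite (lt_trans xr)// ltrDl.
  have [|z' xz'] := WK (x + lat z).
    by split=> //; exists z; rewrite addrK.
  have [->|/eqP/(far _ _ (x + lat z) (x + lat z))] := eqVneq z z'.
    by rewrite addrK.
  by move: xr xz' e0 del_gt0; rewrite subrr normr0 addrK /L; lra.
apply: delone_val_inj; apply/seteqP; split=> x /=.
  move=> [s Ws <-]; apply: WG => //; exists (- p).
    by move=> z; rewrite -[LHS]pS subrK.
  by rewrite -sub0r /lat lattice_pointB lattice_point0 sub0r.
move=> Wx; exists (x + lattice_point L p); last by rewrite addrK.
by apply: WG => //; exists p.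
Qed.

End Gluing.

(** * The local rubber topology *)

Section RubberTopology.
Context {R : realType} {n : nat} {eps del : R}.
Local Notation Del := (delone_set n eps del).
Implicit Types (S T : Del) (v x : 'rV[R]_n) (r : R).

Definition rubber_ball r : set (Del * Del) := rubber (ball 0 r) (ball 0 r^-1).

Lemma entourage_rubber_ball r r' :
  0 < r -> 0 < r' -> entourage (rubber (ball 0 r) (ball 0 r') : set (Del * Del)).
Proof.
move=> r0 r'0; exists (ball 0 r), (ball 0 r'); split; split=> //.
- exact: open_ball0.
- exact: ballxx.
- exact: precompact_ball0.
- exact: open_ball0.
- exact: ballxx.
Qed.

Lemma rubber_ball_base (A : set (Del * Del)) :
  entourage A -> exists k, rubber_ball k.+1%:R `<=` A.
Proof.
move=> [U [U' [[oU U0 cU] [oU' U'0 UA]]]].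
have [M M0 UM] := precompact_bounded cU.
have /nbhs_ballP[r /= r0 rU'] : nbhs (0 : 'rV[R]_n) U' by exact: open_nbhs_nbhs.
pose k := Num.truncn (M + r^-1); exists k.
have Mrk : M + r^-1 < k.+1%:R by exact: truncnS_gt.
have Mk : M <= k.+1%:R by rewrite (le_trans _ (ltW Mrk))// lerDl invr_ge0 ltW.
have rk : k.+1%:R^-1 <= r.
  by rewrite invf_ple ?posrE// (le_trans _ (ltW Mrk))// lerDr ltW.
have UU : U `<=` ball 0 k.+1%:R by move=> x /UM; exact: le_ball.
have VV : ball (0 : 'rV[R]_n) k.+1%:R^-1 `<=` U'.
  by move=> x xk; apply: rU'; exact: le_ball xk.
move=> [S T] [/= ST TS]; apply: UA; split=> /= x [Sx /UU Ux]; apply: (minkowskiS VV).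
  exact: ST.
exact: TS.
Qed.

Lemma rubber_ball_agree r S T : 0 < r ->
  (forall x, `|x| < r -> delone_val S x <-> delone_val T x) ->
  rubber_ball r (S, T).
Proof.
move=> r0 ST; have b0 : ball (0 : 'rV[R]_n) r^-1 0 by apply: ballxx; rewrite invr_gt0.
by split=> /= x [Sx]; rewrite mem_ball0 => xr; exists x;
  try (by exists 0; rewrite ?addr0); apply/ST.
Qed.

Lemma closure_entourageP (X : set Del) S :
  closure X S <-> forall A, entourage A -> exists2 T, X T & A (S, T).
Proof.
split=> [XS A entA|XS B].
  have [T [XT /xsectionP ST]] := XS _ (nbhs_entourage S entA).
  by exists T.
rewrite -filter_from_entourageE => -[A entA AB].
by have [T XT ST] := XS _ entA; exists T; split=> //; apply/AB/xsectionP.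
Qed.

Lemma delone_translateD v w S :
  delone_translate (v + w) S = delone_translate v (delone_translate w S).
Proof.
apply: delone_val_inj; apply/seteqP; split=> x /=.
  by move=> [s Ss <-]; exists (s - w); [exists s|rewrite opprD addrA addrAC].
by move=> [_ [s Ss <-] <-]; exists s => //; rewrite opprD addrA addrAC.
Qed.

Lemma mem_translate v S x :
  delone_val (delone_translate v S) x <-> delone_val S (x + v).
Proof.
by split=> [[s Ss <-]|Sx]; [rewrite subrK|exists (x + v); rewrite ?addrK].
Qed.

Lemma delone_translate_continuous v :
  continuous (delone_translate v : Del -> Del).
Proof.
move=> S; apply/(@cvg_app_entourageP _ _ _ (nbhs S)) => A /rubber_ball_base[k kA].
have k0 : 0 < k.+1%:R^-1 :> R by rewrite invr_gt0.
have kv0 : 0 < k.+1%:R + `|v| by rewrite ltr_wpDr.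
rewrite -filter_from_entourageE.
exists (rubber (ball 0 (k.+1%:R + `|v|)) (ball 0 k.+1%:R^-1)).
  exact: entourage_rubber_ball kv0 k0.
move=> T /xsectionP[/= ST TS]; apply: kA.
have aux (S1 S2 : Del) : delone_val S1 `&` ball 0 (k.+1%:R + `|v|) `<=`
    minkowski S2 (ball 0 k.+1%:R^-1) ->
    delone_val (delone_translate v S1) `&` ball 0 k.+1%:R `<=`
    minkowski (delone_translate v S2) (ball 0 k.+1%:R^-1).
  move=> S12 x [/mem_translate S1x]; rewrite mem_ball0 => xk.
  have [|y S2y [b bk yb]] := S12 (x + v).
    split=> //; rewrite mem_ball0 (le_lt_trans (ler_normD _ _))//.
    by rewrite ltrD2r.
  exists (y - v); first by exists y.
  by exists b; [exact: bk|rewrite addrAC yb addrK].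
by split; apply: aux.
Qed.

Lemma orbit_map_continuous S : continuous (fun v => delone_translate v S).
Proof.
move=> v; apply/(@cvg_app_entourageP _ _ _ (nbhs v)) => A /rubber_ball_base[k kA].
have k0 : 0 < k.+1%:R^-1 :> R by rewrite invr_gt0.
apply/nbhs_ballP; exists k.+1%:R^-1 => //= w; rewrite -ball_normE /= => vw; apply: kA.
split=> /= x [[s Ss <-] _].
  exists (s - w); first by exists s.
  exists (w - v); last by rewrite addrA subrK.
  by rewrite mem_ball0 distrC.
exists (s - v); first by exists s.
exists (v - w); last by rewrite addrA subrK.
by rewrite mem_ball0.
Qed.

(** Modulo the lattice every translation vector can be moved into a cube, so the
    orbit is the continuous image of a compact set. *)
Lemma lattice_invariant_periodic L S : 0 < L ->
  (forall p, delone_translate (lattice_point L p) S = S) -> periodic S.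
Proof.
move=> L0 SL.
have cube_compact : compact (closed_ball_ (fun x : 'rV[R]_n => `|x|) 0 L).
  apply: bounded_closed_compact; last exact: closed_closed_ball_.
  exists L; split; first exact: num_real.
  by move=> M LM x; rewrite /closed_ball_ /= sub0r normrN => /le_trans; apply; exact: ltW.
have orbitE : delone_orbit S =
    (fun v => delone_translate v S) @` closed_ball_ (fun x : 'rV[R]_n => `|x|) 0 L.
  apply/seteqP; split=> [_ [v _ <-]|_ [v _ <-]]; last by exists v.
  pose p : 'rV[int]_n := map_mx (fun t => Num.floor (t / L)) v.
  exists (v - lattice_point L p); last by rewrite -{1}(SL p) -delone_translateD subrK.
  rewrite /closed_ball_ /= sub0r normrN; apply: norm_le_coord => [|i]; first exact: ltW.
  rewrite !mxE; set t := v ord0 i.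
  have := floor_le (t / L); have := floorD1_gt (t / L).
  rewrite intrD ltr_pdivrMr// ler_pdivlMr// => h1 h2.
  by rewrite ler_norml; apply/andP; split; lra.
rewrite /periodic orbitE; apply: continuous_compact cube_compact.
by apply: continuous_subspaceT; exact: orbit_map_continuous.
Qed.

End RubberTopology.

(** * Dense orbits are generic and chaotic *)

Section Genericity.
Context {R : realType} {n : nat} {eps del : R}.
Hypotheses (n_ge1 : (1 <= n)%N) (del_gt0 : 0 < del) (del_le_eps : del <= eps).
Local Notation Del := (delone_set n eps del).
Implicit Types (S T : Del).

Lemma delone_extension (P : set 'rV[R]_n) :
  separated del P -> exists W : Del, P `<=` delone_val W.
Proof.
move=> sepP.
have [] := @extend_separated R n eps del del_gt0 del_le_eps [set 0] P set0.
- by [].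
- by move=> _ _ -> ->; rewrite subr0.
- by move=> _ ->.
- by [].
- by move=> _ x -> Px; rewrite addr0.
- by move=> _ x _ [].
- by move=> x [].
- by move=> W [Wdel _ PW _]; exists (DeloneSet Wdel).
Qed.

(** The cube of radius [r] is cut into finitely many cells of side [r^-1].  Two
    Delone sets that meet the same cells are [r^-1]-close in that cube, so one
    representative for each finite set of cells is enough. *)
Lemma countable_rubber_cover (r : R) : 0 < r ->
  exists D : nat -> Del, forall T, exists j, rubber_ball r (D j, T).
Proof.
move=> r0; have [T0 _] : exists W : Del, set0 `<=` delone_val W.
  by apply: delone_extension => x y [].
pose coord (t : R) := Num.truncn (r * (t + r)).
pose N := Num.truncn (r * (r + r)).
pose cell (x : 'rV[R]_n) : {ffun 'I_n -> 'I_N.+1} := [ffun i => inord (coord (x ord0 i))].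
pose trace T := [set c | `[< exists2 x, delone_val T x & `|x| < r /\ cell x = c >]]%SET.
have cell_near x y : `|x| < r -> `|y| < r -> cell x = cell y -> `|x - y| < r^-1.
  move=> xr yr /ffunP xy; apply: norm_lt_coord => [|i]; first by rewrite invr_gt0.
  have coordP (z : 'rV[R]_n) : `|z| < r ->
      0 <= r * (z ord0 i + r) /\ (coord (z ord0 i) < N.+1)%N.
    move=> zr; have := le_lt_trans (coord_le_norm z i) zr.
    rewrite ltr_norml => /andP[h1 h2]; split; first by rewrite mulr_ge0 ?ltW//; lra.
    by rewrite ltnS le_truncn// ler_wpM2l ?lerD2r// ltW.
  have [[x0 xN] [y0 yN]] := (coordP x xr, coordP y yr).
  have := xy i; rewrite !ffunE => /(congr1 val) /=; rewrite !inordK// => E.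
  move/andP: (truncn_itv x0) => [x1 x2]; move/andP: (truncn_itv y0) => [y1 y2].
  move: x1 x2 y1 y2; rewrite -/(coord _) -/(coord (y ord0 i)) E -natr1 => x1 x2 y1 y2.
  rewrite !mxE -(ltr_pM2l r0) mulfV ?gt_eqF// -{1}(gtr0_norm r0) -normrM ltr_norml.
  by apply/andP; split; lra.
pose D j := xget T0 [set T | unpickle j = Some (trace T)].
exists D => T; exists (pickle (trace T)).
have : trace T = trace (D (pickle (trace T))).
  have : [set T' | unpickle (pickle (trace T)) = Some (trace T')] (D (pickle (trace T))).
    by apply: xgetPex; exists T; rewrite /= pickleK.
  by rewrite /= pickleK => -[].
move: (D _) => T' TT'.
have same_trace (T1 T2 : Del) : trace T1 = trace T2 ->
    delone_val T1 `&` ball 0 r `<=` minkowski T2 (ball 0 r^-1).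
  move=> T12 x []; rewrite mem_ball0 => T1x xr.
  have : cell x \in trace T2 by rewrite -T12 inE; apply/asboolP; exists x.
  rewrite inE => /asboolP[y T2y [yr xy]]; exists y => //; exists (x - y).
    by rewrite mem_ball0; apply: cell_near.
  by rewrite addrC subrK.
by split; apply: same_trace.
Qed.

Lemma periodic_dense T (A : set (Del * Del)) :
  entourage A -> exists2 W : Del, periodic W & A (T, W).
Proof.
move=> /rubber_ball_base[k kA].
have [//|L [W [L0 [WT Wper]]]] := glue del_gt0 del_le_eps (fun=> T) (r := k.+1%:R).
exists W; first by apply: lattice_invariant_periodic L0 _ => p; exact: Wper.
apply/kA/rubber_ball_agree => // x xk.
by rewrite -(WT 0 x xk) lattice_point0 addr0.
Qed.

(** The sections of an entourage are neighbourhoods that need not be open, hence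
    the interior. *)
Definition visits (A : set (Del * Del)) T : set Del :=
  \bigcup_v delone_translate v @^-1` (xsection A T)°.

Lemma open_visits A T : open (visits A T).
Proof.
apply: bigcup_open => v _; apply: open_comp; last exact: open_interior.
by move=> S _; exact: delone_translate_continuous.
Qed.

Lemma dense_visits A T : entourage A -> dense (visits A T).
Proof.
move=> entA O [S OS] openO.
have : nbhs S O by exact: open_nbhs_nbhs.
rewrite -filter_from_entourageE => -[B /rubber_ball_base[k kB] BO].
have : nbhs T (xsection A T)° by apply: nbhs_interior; exact: nbhs_entourage.
rewrite -filter_from_entourageE => -[C /rubber_ball_base[l lC] CA].
pose r : R := k.+1%:R + l.+1%:R.
have r0 : 0 < r by rewrite addr_gt0.
pose F (z : 'rV[int]_n) := if z == 0 then S else T.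
have [L [W [_ [WF _]]]] := glue del_gt0 del_le_eps F r0.
have one_neq0 : (const_mx 1 : 'rV[int]_n) != 0.
  apply/eqP => /rowP /(_ (Ordinal n_ge1)); rewrite !mxE => /eqP.
  by rewrite oner_eq0.
exists W; split.
  apply/BO/xsectionP/kB/rubber_ball_agree => // x xk.
  have xr : `|x| < r by rewrite (lt_trans xk)// ltrDl.
  by have := WF 0 x xr; rewrite /F eqxx lattice_point0 addr0 => ->.
exists (lattice_point L (const_mx 1)) => //=.
apply/CA/xsectionP/lC/rubber_ball_agree => // x xl.
have xr : `|x| < r by rewrite (lt_trans xl)// ltrDr.
by rewrite mem_translate WF // /F (negbTE one_neq0).
Qed.

(** If [S] has period [v], any [s] in a translate of [S] comes with [s + v].  Two
    points of [S] differ by [v], so [v] has length at least [del] and [0] and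
    [a *: v], for [a] slightly above 1, belong to a common Delone set [T].  No
    point of [T] is near [v]: the point [a *: v] is at positive distance from it,
    and all others are at distance at least [del] from [a *: v].  A translate of
    [S] close to [T] has a point [s] near 0, hence [s + v] near [v], a
    contradiction. *)
Lemma dense_orbit_aperiodic S :
  (forall T, closure (delone_orbit S) T) -> aperiodic S.
Proof.
move=> orbitS v v0 Sv.
have invS x : delone_val S x -> delone_val S (x + v).
  by rewrite -{1}Sv mem_translate.
have nv0 : 0 < `|v| by rewrite normr_gt0.
have dv : del <= edist 0 v.
  have [cov sep] := delone_valP S; have [s Ss _] := cov 0.
  rewrite -(edistDr _ _ s) add0r addrC; apply: sep => //; first exact: invS.
  by rewrite -[s in s = _]addr0 => /addrI/esym/eqP; exact/negP.
have n0 : 0 < n%:R :> R by rewrite ltr0n.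
(* The Euclidean distance is at most [n] times the sup distance, so points
   within [2 * rho] of each other in the sup norm are at Euclidean distance
   at most [del]. *)
pose rho := del / (2 * n%:R).
have rho0 : 0 < rho by rewrite divr_gt0// mulr_gt0.
pose a := 1 + rho / `|v|.
have rv0 : 0 < rho / `|v| by rewrite divr_gt0.
have a1 : 1 <= a by rewrite lerDl ltW.
have av : `|a *: v - v| = rho.
  rewrite -[v in _ - v]scale1r -scalerBl /a addrAC subrr add0r normrZ.
  by rewrite gtr0_norm// divfK// gt_eqF.
have dav : del <= edist 0 (a *: v).
  by rewrite edist0Z ?(le_trans ler01)// (le_trans dv)// ler_peMl ?(le_trans _ dv)// ltW.
have [T TP] : exists T : Del, [set 0; a *: v] `<=` delone_val T.
  by apply: delone_extension => x y [->|->] [->|->] //; rewrite edistC.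
have Tfar t : delone_val T t -> rho <= `|t - v|.
  move=> Tt; have [->|/eqP tav] := eqVneq t (a *: v); first by rewrite av.
  rewrite leNgt; apply/negP => tv.
  have [_ sep] := delone_valP T.
  have : del <= edist t (a *: v) by apply: sep => //; apply: TP; right.
  apply/negP; rewrite -ltNge; apply: le_lt_trans (edist_le_norm _ _) _.
  have -> : del = n%:R * (rho + rho).
    by rewrite /rho; field; rewrite gt_eqF.
  rewrite ltr_pM2l//.
  have -> : t - a *: v = (t - v) - (a *: v - v) by rewrite opprB addrA subrK.
  by rewrite (le_lt_trans (ler_normB _ _))// av ltrD2r.
(* Large enough for [s + v] to be seen when [s] is near 0, and for two successive
   approximations up to [r^-1] to stay below [rho]. *)
pose r := 1 + `|v| + 2 / rho.
have rr0 : 0 < 2 / rho by rewrite divr_gt0.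
have r1 : 1 < r by rewrite /r; move: nv0; lra.
have r0 : 0 < r by exact: lt_trans r1.
have ri0 : 0 < r^-1 by rewrite invr_gt0.
have ri1 : r^-1 < 1 by rewrite invf_lt1.
have r2 : r^-1 + r^-1 < rho.
  have -> : r^-1 + r^-1 = 2 / r by rewrite -mulr2n mulr_natl.
  by rewrite ltr_pdivrMr// mulrC -ltr_pdivrMr// /r; move: nv0; lra.
have [_ [w _ <-] [TS ST]] := (closure_entourageP _ _).1 (orbitS T) _
  (entourage_rubber_ball r0 ri0).
have [|s Ss [b]] := TS 0; first by split; [apply: TP; left|rewrite mem_ball0 normr0].
rewrite mem_ball0 => br sb0.
have sb : s = - b by apply/eqP; rewrite -addr_eq0 sb0.
have [|t Tt [c]] := ST (s + v).
  split; first by apply/mem_translate; rewrite addrAC; apply/invS/mem_translate.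
  rewrite mem_ball0 (le_lt_trans (ler_normD _ _))// sb normrN//.
  by rewrite /r; move: nv0; lra.
rewrite mem_ball0 => cr tc.
have := Tfar t Tt; apply/negP; rewrite -ltNge (lt_trans _ r2)//.
have -> : t - v = - b - c by rewrite -(addrK c t) tc sb addrAC addrK.
by rewrite (le_lt_trans (ler_normB _ _))// normrN ltrD.
Qed.

Lemma dense_orbit_almost_chaotic S :
  (forall T, closure (delone_orbit S) T) -> almost_chaotic S.
Proof.
move=> orbitS T _; apply/closure_entourageP => A /(periodic_dense T)[W perW TW].
exists W => //; exists W; first by split=> // T' _; exact: orbitS.
exists 0 => //; apply: delone_val_inj; apply/seteqP.
by split=> x; rewrite mem_translate addr0.
Qed.

End Genericity.

Theorem theorem1p3 (R : realType) (n : nat) (eps del : R)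
  (n_ge1 : (1 <= n)%N) (eps_gt0 : 0 < eps) (del_gt0 : 0 < del)
  (del_le_eps : del <= eps) :
  exists F : nat -> set (delone_set n eps del),
    (forall k, open (F k) /\ dense (F k)) /\
    \bigcap_k F k `<=` [set S | chaotic S].
Proof.
have /boolp.choice[D Dcover] : forall k, exists Dk : nat -> delone_set n eps del,
    forall T, exists j, rubber_ball k.+1%:R (Dk j, T).
  by move=> k; exact: countable_rubber_cover.
pose G (kj : nat * nat) := visits (rubber_ball kj.1.+1%:R) (D kj.1 kj.2).
exists (fun i => if unpickle i is Some kj then G kj else setT); split.
  move=> i; case: unpickle => [kj|]; last first.
    by split=> [|U [S US] _]; [exact: openT|exists S].
  split; first exact: open_visits.
  by apply: dense_visits => //; apply: entourage_rubber_ball; rewrite ?invr_gt0.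
move=> S SG; suff orbitS T : closure (delone_orbit S) T.
  by split; [exact: dense_orbit_almost_chaotic|exact: dense_orbit_aperiodic].
apply/closure_entourageP => A /entourage_split_ex[B entB BA].
have [k kB] := rubber_ball_base (entourage_invI entB).
have [j DT] := Dcover k T.
have := SG (pickle (k, j)) I; rewrite /= pickleK => -[v _ /interior_subset/xsectionP DS].
exists (delone_translate v S); first by exists v.
by apply: BA; exists (D k j); [exact: (kB _ DT).2|exact: (kB _ DS).1].
Qed.
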